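(* Let $\boldsymbol{u}$ be the solution of the full-order parameter-dependent dynamical system with flux $\boldsymbol{f}$ and initial condition $\boldsymbol{u}^0(\boldsymbol{\xi})$, let $\boldsymbol{u}_r$ be its Galerkin approximation in the time-dependent reduced spaces $X_r(t)$, and let $\boldsymbol{e}_r=\boldsymbol{u}-\boldsymbol{u}_r$ (all as defined in the context). Then, for every $\boldsymbol{\xi}\in\boldsymbol{\Xi}$, the error norm satisfies $$\|\boldsymbol{e}_r(t,\boldsymbol{\xi})\|_X\le \Delta_r(t,\boldsymbol{\xi})\qquad\text{for all } t\ge 0,$$ where $t\mapsto\Delta_r(t,\boldsymbol{\xi})$ is the solution of the scalar ordinary differential equation $$\begin{cases}\Delta_r'(t,\boldsymbol{\xi}) = L_X[\boldsymbol{f}](\boldsymbol{u}_r(t,\boldsymbol{\xi}))\,\Delta_r(t,\boldsymbol{\xi})+\|\boldsymbol{r}(t,\boldsymbol{\xi})\|_X,\\ \Delta_r(0,\boldsymbol{\xi})=\|\boldsymbol{e}_r(0,\boldsymbol{\xi})\|_X,\end{cases}$$ with $$\boldsymbol{r}(t,\boldsymbol{\xi})=\boldsymbol{\Pi}_{X_r^\perp}(t)\Big(\mathbf{V}_r'(t)\mathbf{V}_r(t)^T\boldsymbol{u}_r(t,\boldsymbol{\xi})-\boldsymbol{f}(\boldsymbol{u}_r(t,\boldsymbol{\xi}),t,\boldsymbol{\xi})\Big)$$ and $\boldsymbol{e}_r(0,\boldsymbol{\xi})=\boldsymbol{u}^0(\boldsymbol{\xi})-\boldsymbol{\Pi}_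{X_r}(0)\boldsymbol{u}^0(\boldsymbol{\xi})$.
   Context: Let $X=\mathbb{R}^d$ be equipped with the canonical inner product $\langle \boldsymbol{x},\boldsymbol{y}\rangle_X=\boldsymbol{x}^T\boldsymbol{y}$ and associated norm $\|\cdot\|_X$. Let $\boldsymbol{\Xi}$ be a parameter set, and for $\boldsymbol{\xi}\in\boldsymbol{\Xi}$ let $\boldsymbol{u}^0(\boldsymbol{\xi})\in X$ and let $\boldsymbol{f}(\cdot,\cdot,\boldsymbol{\xi}):X\times[0,\infty)\to X$ be the flux. For each fixed $\boldsymbol{\xi}$, the map $(\boldsymbol{v},t)\mapsto\boldsymbol{f}(\boldsymbol{v},t,\boldsymbol{\xi})$ is continuous and $\boldsymbol{v}\mapsto \boldsymbol{f}(\boldsymbol{v},t,\boldsymbol{\xi})$ is Lipschitz continuous, uniformly in $t$. Primes denote derivatives with respect to $t$. Full-order system: $\boldsymbol{u}(\cdot,\boldsymbol{\xi}):[0,\infty)\to X$ is the solution of $\boldsymbol{u}'(t,\boldsymbol{\xi})=\boldsymbol{f}(\boldsymbol{u}(t,\boldsymbol{\xi}),t,\boldsymbol{\xi})$, $\boldsymbol{u}(0,\boldsymbol{\xi})=\boldsymbol{u}^0(\boldsymbol{\xi})$. Reduced spaces: $X_r(t)\subset X$, $t\ge 0$, is a given family of subspaces with $\dim X_r(t)=r$ for all $t>0$; the dimension of $X_r(0)$ is allowed to be different from $r$. For $t>0$, $\{\boldsymbol{v}_1(t),\dots,\boldsymbol{v}_r(t)\}$ is an orthonormal basis of $X_r(t)$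 and $\mathbf{V}_r(t)=[\boldsymbol{v}_1(t),\dots,\boldsymbol{v}_r(t)]\in\mathbb{R}^{d\times r}$, so $\mathbf{V}_r(t)^T\mathbf{V}_r(t)=\mathbf{I}_r$ (identity matrix); $t\mapsto \mathbf{V}_r(t)$ is continuously differentiable for $t>0$ with $\mathbf{V}_r'$ uniformly bounded. For $t\ge0$, $\boldsymbol{\Pi}_{X_r}(t)$ is the orthogonal projector onto $X_r(t)$ (equal to $\mathbf{V}_r(t)\mathbf{V}_r(t)^T$ for $t>0$) and $\boldsymbol{\Pi}_{X_r^\perp}(t)=\mathbf{I}_d-\boldsymbol{\Pi}_{X_r}(t)$ is the orthogonal projector onto its orthogonal complement. Galerkin approximation: $\boldsymbol{u}_r(t,\boldsymbol{\xi})\in X_r(t)$, continuous in $t\ge 0$ and continuously differentiable in $t>0$, is defined by $$\boldsymbol{\Pi}_{X_r}(t)\boldsymbol{u}_r'(t,\boldsymbol{\xi})=\boldsymbol{\Pi}_{X_r}(t)\boldsymbol{f}(\boldsymbol{u}_r(t,\boldsymbol{\xi}),t,\boldsymbol{\xi})\quad (t>0),\qquad \boldsymbol{u}_r(0,\boldsymbol{\xi})=\boldsymbol{\Pi}_{X_r}(0)\boldsymbol{u}^0(\boldsymbol{\xi}).$$ Writing $\boldsymbol{u}_r(t,\boldsymbol{\xi})=\mathbf{V}_r(t)\boldsymbol{\alpha}_r(t,\boldsymbol{\xi})$ with $\boldsymbol{\alpha}_r(t,\boldsymbol{\xi})=\mathbf{V}_r(t)^T\boldsymbol{u}_r(t,\boldsymbol{\xi})\in\mathbb{R}^r$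 for $t>0$, the projected equation is equivalent to $$\boldsymbol{\alpha}_r'(t,\boldsymbol{\xi})=\mathbf{V}_r(t)^T\boldsymbol{f}(\mathbf{V}_r(t)\boldsymbol{\alpha}_r(t,\boldsymbol{\xi}),t,\boldsymbol{\xi})-\mathbf{V}_r(t)^T\mathbf{V}_r'(t)\boldsymbol{\alpha}_r(t,\boldsymbol{\xi}).$$ Local logarithmic Lipschitz constant: for a Lipschitz continuous $\boldsymbol{g}:X\to X$ and $\boldsymbol{v}\in X$, $$L_X[\boldsymbol{g}](\boldsymbol{v})=\sup_{\boldsymbol{w}\in X,\ \boldsymbol{w}\ne\boldsymbol{v}}\frac{\langle\boldsymbol{w}-\boldsymbol{v},\boldsymbol{g}(\boldsymbol{w})-\boldsymbol{g}(\boldsymbol{v})\rangle_X}{\|\boldsymbol{w}-\boldsymbol{v}\|_X^2}.$$ The notation $L_X[\boldsymbol{f}](\boldsymbol{u}_r(t,\boldsymbol{\xi}))$ means this constant for the map $\boldsymbol{g}=\boldsymbol{f}(\cdot,t,\boldsymbol{\xi})$ at the point $\boldsymbol{v}=\boldsymbol{u}_r(t,\boldsymbol{\xi})$. The solution $\Delta_r$ of the scalar differential equation is understood as the locally absolutely continuous function on $[0,\infty)$ with the given initial value that satisfies the equation for almost every $t>0$. *)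

(* Defs.v *)
From HB Require Import structures.
From mathcomp Require Import all_boot all_order all_algebra.
From mathcomp Require Import all_classical all_reals all_analysis.

Set Implicit Arguments.
Unset Strict Implicit.
Unset Printing Implicit Defensive.

Import Order.TTheory GRing.Theory Num.Theory.
Import numFieldNormedType.Exports.

Local Open Scope classical_set_scope.
Local Open Scope ring_scope.

(* The library norm [`|x|] on matrices is the max-entry norm, hence the
   separate Euclidean norm; the topology on ['cV[R]_d] is the same for both. *)
Definition inner (R : realType) (d : nat) (x y : 'cV[R]_d) : R :=
  (x^T *m y) 0 0.

Definition enorm (R : realType) (d : nat) (x : 'cV[R]_d) : R :=
  Num.sqrt (inner x x).

(* The real supremum is meaningful because the quotients are bounded by the
   Lipschitz constant of [g]; for d = 0 the set is empty and the value is 0. *)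
Definition log_lip (R : realType) (d : nat) (g : 'cV[R]_d -> 'cV[R]_d)
    (v : 'cV[R]_d) : R :=
  sup [set inner (w - v) (g w - g v) / enorm (w - v) ^+ 2
      | w in [set w : 'cV[R]_d | w != v]].

(* A time-dependent object is a total function of [t : R] of which only the
   values at t >= 0 (or t > 0) are constrained. *)

Definition regular_flux (R : realType) (d : nat)
    (g : 'cV[R]_d -> R -> 'cV[R]_d) : Prop :=
  {within [set p : 'cV[R]_d * R | 0 <= p.2],
     continuous (fun p : 'cV[R]_d * R => g p.1 p.2)} /\
  exists L : R, forall t : R, 0 <= t -> forall v w : 'cV[R]_d,
    enorm (g v t - g w t) <= L * enorm (v - w).

(* Continuity at 0 together with the equation on t > 0 gives the one-sided
   derivative at 0, as the flux is continuous on t >= 0. *)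
Definition ivp_solution (R : realType) (d : nat)
    (g : 'cV[R]_d -> R -> 'cV[R]_d) (x0 : 'cV[R]_d)
    (x : R -> 'cV[R]_d) : Prop :=
  [/\ {within `[0, +oo[, continuous x},
      forall t : R, 0 < t -> is_derive t 1 x (g (x t) t)
    & x 0 = x0].

Definition orthonormal_basis (R : realType) (d r : nat)
    (U : {vspace 'cV[R]_d}) (B : 'M[R]_(d, r)) : Prop :=
  basis_of U [seq col j B | j : 'I_r] /\
  forall i j : 'I_r, inner (col i B) (col j B) = (i == j)%:R.

Definition orth_projector (R : realType) (d : nat)
    (U : {vspace 'cV[R]_d}) (P : 'M[R]_d) : Prop :=
  forall x : 'cV[R]_d,
    P *m x \in U /\ forall y : 'cV[R]_d, y \in U -> inner (x - P *m x) y = 0.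

Definition C1_pos (R : realType) (W : normedModType R) (x : R -> W) : Prop :=
  forall t : R, 0 < t -> derivable x t 1 /\ {for t, continuous x^`()%classic}.

Definition galerkin (R : realType) (d : nat)
    (Xr : R -> {vspace 'cV[R]_d}) (Pi : R -> 'M[R]_d)
    (g : 'cV[R]_d -> R -> 'cV[R]_d) (x0 : 'cV[R]_d)
    (x : R -> 'cV[R]_d) : Prop :=
  [/\ forall t : R, 0 <= t -> x t \in Xr t,
      {within `[0, +oo[, continuous x},
      C1_pos x,
      forall t : R, 0 < t -> Pi t *m x^`()%classic t = Pi t *m g (x t) t
    & x 0 = Pi 0 *m x0].

Definition residual (R : realType) (d r : nat) (Pi : R -> 'M[R]_d)
    (V : R -> 'M[R]_(d, r)) (g : 'cV[R]_d -> R -> 'cV[R]_d)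
    (x : R -> 'cV[R]_d) (t : R) : 'cV[R]_d :=
  (1%:M - Pi t) *m (V^`()%classic t *m (V t)^T *m x t - g (x t) t).

Definition abs_continuous (R : realType) (a b : R) (F : R -> R) : Prop :=
  forall e : R, 0 < e -> exists2 delta : R, 0 < delta &
    forall (n : nat) (l u : 'I_n -> R),
      (forall i, a <= l i /\ l i <= u i /\ u i <= b) ->
      trivIset setT (fun i => `]l i, u i[%classic) ->
      \sum_(i < n) (u i - l i) < delta ->
      \sum_(i < n) `|F (u i) - F (l i)| < e.

Definition caratheodory_solution (R : realType) (a b : R -> R) (y0 : R)
    (y : R -> R) : Prop :=
  [/\ forall T : R, 0 < T -> abs_continuous 0 T y,
      {ae lebesgue_measure, forall t : R,
         0 < t -> is_derive t 1 y (a t * y t + b t)}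
    & y 0 = y0].

(* Main.v *)
Require Import Defs.
From HB Require Import structures.
From mathcomp Require Import all_boot all_order all_algebra.
From mathcomp Require Import all_classical all_reals all_analysis.
From mathcomp Require Import ring lra.

Set Implicit Arguments.
Unset Strict Implicit.
Unset Printing Implicit Defensive.

Import Order.TTheory GRing.Theory Num.Theory.
Import numFieldNormedType.Exports.

Local Open Scope classical_set_scope.
Local Open Scope ring_scope.

(** Write [e = u - ur] and let [r] be the residual.

    For [t > 0] the reduced solution satisfies the exact equation
    [ur' = f(ur) + r] ([galerkin_derive]): the part of [ur'] in the reduced
    space is prescribed by the Galerkin condition, and the part orthogonal to
    it can only come from the motion of the space, because in
    [ur = V alpha] the term [V alpha'] is killed by the orthogonal projector.
    Hence [e' = f(u) - f(ur) - r], and wherever [e] does not vanish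
    [|e|' = <e, e'> / |e| <= L |e| + |r|], by the definition of the local
    logarithmic Lipschitz constant [L] and the Cauchy-Schwarz inequality.

    It remains to compare [|e|] with [Delta], which satisfies the
    corresponding equation only almost everywhere ([scalar_comparison]). The
    comparison is applied twice: to the zero function, which gives
    [0 <= Delta], and then to [|e|]. It only looks at times where the
    compared function exceeds [Delta]; for [|e|] the bound [0 <= Delta] then
    guarantees that [|e|] is positive, hence differentiable, at these times.

    Nothing makes [t |-> L] continuous, so the comparison does not integrate
    the differential inequality. It rests on a direct mean value inequality
    ([ac_growth]): if [p] is differentiable with [p'] bounded above, [D] is
    absolutely continuous and [(p - D)' <= c] almost everywhere, then [p - D]
    grows at most at rate [c]. That is a Cousin covering argument: around a
    good point the derivative controls the increment, and the exceptional null
    set is covered by an open set so small that the absolute continuity of [D]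
    and the bound on [p'] make its contribution negligible. From there, the
    upper bound [K] of [L] bounds the growth rate of [w = p - D] by [K w], and
    a function starting from a nonpositive value cannot become positive
    ([nonpos_of_growth]), for on a short interval it would have to be smaller
    than half of its own maximum. *)

(** * Functions controlled by almost everywhere derivatives *)

(** The compactness of [[a, b]] in the form of Cousin's lemma: a property that
    crosses every point [x] of the interval, from somewhere just before [x] to
    somewhere just after, propagates from [a] to [b]. The threshold [d] may
    depend on [x] without any uniformity. *)
Lemma cousin_induction (R : realType) (a b : R) (G : set R) :
  a <= b -> G a ->
  (forall x, a <= x <= b -> exists2 d : R, 0 < d &
     forall y z, a <= y -> x - d < y -> y <= x -> x <= z -> z < x + d ->
       z <= b -> G y -> G z) ->
  G b.
Proof.
move=> ab Ga step.
pose S := [set x | [/\ a <= x, x <= b & G x]].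
have Sa : S a by split.
have ubS : ubound S b by move=> x [].
have hS : has_sup S by split; [exists a|exists b].
pose c := sup S.
have ac : a <= c by apply: ub_le_sup => //; exists b.
have cb : c <= b by apply: ge_sup => //; exists a.
have [d d0 stepc] : exists2 d : R, 0 < d &
     forall y z, a <= y -> c - d < y -> y <= c -> c <= z -> z < c + d ->
       z <= b -> G y -> G z by apply: step; rewrite ac cb.
have [y [ay yb Gy] cdy] := sup_adherent d0 hS.
have yc : y <= c by apply: ub_le_sup => //; exists b.
have [bd|bd] := ltP b (c + d); first by apply: (stepc y b) => //; lra.
have : c + d / 2 <= c.
  apply: ub_le_sup; first by exists b.
  have Gz : G (c + d / 2) by apply: (stepc y) => //; lra.
  by split => //; lra.
lra.
Qed.

(** The two endpoints straddle [x] instead of one of them being [x], which is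
    what the intervals met in [cousin_induction] provide. The condition
    [y <= x <= z] matters: only then do the errors on both sides of [x] add up
    to [e * (z - y)]. *)
Lemma derive_straddle (R : realType) (F : R -> R) (x dF e : R) :
  is_derive x 1 F dF -> 0 < e ->
  exists2 d : R, 0 < d &
    forall y z, x - d < y -> y <= x -> x <= z -> z < x + d ->
      `|F z - F y - dF * (z - y)| <= e * (z - y).
Proof.
move=> [Fx dFx] e0.
have : (fun h : R => h^-1 *: ((F \o shift x) (h *: (1 : R)) - F x)) @ 0^'
    --> dF.
  by rewrite -dFx; exact: Fx.
move=> /cvgrPdist_le /(_ _ e0) /= [d /= d0 Hd].
have one h : `|h| < d -> `|F (x + h) - F x - dF * h| <= e * `|h|.
  move=> hd; have [->|h0] := eqVneq h 0.
    by rewrite addr0 subrr mulr0 subr0 normr0 mulr0.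
  have := Hd h; rewrite /ball_ /= sub0r normrN => /(_ hd h0).
  rewrite /GRing.scale /= mulr1 => H.
  have -> : F (x + h) - F x - dF * h = - ((dF - h^-1 * (F (h + x) - F x)) * h).
    by rewrite (addrC h) mulrBl mulrAC mulVf// mul1r; ring.
  by rewrite normrN normrM ler_pM2r ?normr_gt0.
exists d => // y z dy yx xz zd.
have h1 := one (z - x); have h2 := one (y - x).
rewrite !(addrC x) !subrK in h1 h2.
have {}h1 : `|F z - F x - dF * (z - x)| <= e * (z - x).
  rewrite -[X in _ <= e * X](@ger0_norm _ (z - x)) ?subr_ge0// h1//.
  by rewrite ger0_norm; lra.
have {}h2 : `|F y - F x - dF * (y - x)| <= e * (x - y).
  rewrite -[X in _ <= e * X](@ger0_norm _ (x - y)) ?subr_ge0// distrC.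
  by rewrite -(distrC y x) distrC; apply: h2; rewrite ler0_norm; lra.
have -> : F z - F y - dF * (z - y) =
   (F z - F x - dF * (z - x)) - (F y - F x - dF * (y - x)) by ring.
apply: le_trans (ler_normB _ _) _; apply: le_trans (lerD h1 h2) _.
by rewrite le_eqVlt; apply/orP; left; apply/eqP; ring.
Qed.

Lemma disjoint_intervals_length (R : realType) (U : set R) (n : nat)
    (l u : nat -> R) :
  measurable U ->
  (forall i, (i < n)%N -> l i <= u i /\ `]l i, u i[ `<=` U) ->
  trivIset setT (fun i : 'I_n => `]l i, u i[%classic) ->
  ((\sum_(i < n) (u i - l i))%:E <= lebesgue_measure U)%E.
Proof.
move=> mU lu tI.
have -> : (\sum_(i < n) (u i - l i))%:E =
    lebesgue_measure (\big[setU/set0]_(i < n) (`]l i, u i[%classic : set R)).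
  rewrite measure_bigsetU_ord//= -sumEFin; apply: eq_bigr => i _.
  rewrite lebesgue_measure_itv/= lte_fin EFinB.
  have [//|] := ltP (l i) (u i).
  have [lui _] := lu i (ltn_ord i) => uil.
  have -> : u i = l i by apply/eqP; rewrite eq_le uil lui.
  by rewrite -EFinB subrr.
apply: le_measure; rewrite ?inE//.
  by apply: bigsetU_measurable => i _.
rewrite -(bigcup_mkord n (fun i => `]l i, u i[%classic)).
by move=> x [i ni]; have [_] := lu i ni; apply.
Qed.

Section growth.
Variables (R : realType) (U : set R) (p D : R -> R) (a b c C : R).

(** The invariant carried from [a] to [b] by [cousin_induction]: the growth of
    [p - D] on [[a, x]] has rate [c], up to finitely many successive intervals
    [[l i, u i]] inside [U], where [D] pays its variation and [p] its maximal
    slope [C]. The intervals are listed in increasing order so that their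
    disjointness survives the addition of a new last one. *)
Definition growth_certificate : set R :=
  [set x | exists (n : nat) (l u : nat -> R),
  [/\ forall i, (i < n)%N ->
        [/\ a <= l i, l i <= u i, u i <= x & `]l i, u i[ `<=` U],
      forall i j, (i < j)%N -> (j < n)%N -> u i <= l j
    & (p x - D x) - (p a - D a) <= c * (x - a) +
        \sum_(i < n) `|D (u i) - D (l i)| + C * \sum_(i < n) (u i - l i)]].

Lemma growth_certificate_small (y z : R) : y <= z ->
  (p z - D z) - (p y - D y) <= c * (z - y) ->
  growth_certificate y -> growth_certificate z.
Proof.
move=> yz H [n [l [u [lu ord G]]]]; exists n, l, u; split => //; last lra.
by move=> i /lu[? ? ? ?]; split => //; lra.
Qed.

Lemma growth_certificate_cover (y z : R) : a <= y -> y <= z -> 0 <= c ->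
  `]y, z[ `<=` U -> p z - p y <= C * (z - y) ->
  growth_certificate y -> growth_certificate z.
Proof.
move=> ay yz c0 yzU H [n [l [u [lu ord G]]]].
exists n.+1, (fun i => if (i < n)%N then l i else y),
  (fun i => if (i < n)%N then u i else z); split.
- move=> i; case: ifPn => [/lu[? ? ? ?] _|_ _]; split => //; lra.
- move=> i j ij; rewrite ltnS leq_eqVlt => /orP[/eqP jn|jn].
    rewrite jn ltnn -{1}jn ij; have [] // := lu i; by rewrite -jn.
  by rewrite jn (ltn_trans ij jn); exact: ord.
rewrite !big_ord_recr /= ltnn.
under eq_bigr do rewrite ltn_ord.
under [X in C * (X + _)]eq_bigr do rewrite ltn_ord.
have := mulr_ge0 c0 (_ : 0 <= z - y); rewrite subr_ge0 => /(_ yz) czy.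
have := ler_norm (- (D z - D y)); rewrite normrN => Dn.
lra.
Qed.

End growth.

(** A mean value inequality with an exceptional null set. Absolute continuity
    is required of [D] only: for [p], an upper bound [C] on its derivative,
    itself assumed to exist everywhere, plays the same role. *)
Lemma ac_growth (R : realType) (p dp D dD : R -> R) (a b c C : R) :
  a <= b -> 0 <= c -> abs_continuous a b D ->
  (forall x, a <= x <= b -> is_derive x 1 p (dp x) /\ dp x <= C) ->
  {ae lebesgue_measure, forall x : R, a <= x <= b ->
     is_derive x 1 D (dD x) /\ dp x - dD x <= c} ->
  (p b - D b) - (p a - D a) <= c * (b - a).
Proof.
move=> ab c0 acD dpC [N [mN N0 subN]].
have {}N0 : lebesgue_measure N = 0%E by exact: N0.
have Noo : (lebesgue_measure N < +oo)%E by rewrite N0 ltry.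
apply/ler_addgt0Pr => e e0.
(* The rate [e1] costs at most [e / 2] over [[a, b]], and each of the two sums
   over the intervals inside [U] costs at most [e2]. *)
pose e1 := e / (2 * (b - a + 1)); pose e2 := e / 4.
pose C1 := `|C| + 1.
have C1C : C + 1 <= C1 by rewrite /C1 lerD2r ler_norm.
have C10 : 0 < C1 by rewrite /C1 ltr_wpDl.
have e10 : 0 < e1 by rewrite divr_gt0// mulr_gt0//; lra.
have e20 : 0 < e2 by rewrite divr_gt0.
have [delta delta0 acDe] := acD _ e20.
pose m := Num.min delta (e2 / C1).
have m0 : 0 < m by rewrite lt_min delta0 divr_gt0.
have [U [oU NU UN]] := @lebesgue_regularity_outer R N m mN Noo m0.
have mU : measurable U by exact: measurable_realfun.open_measurable.
have {UN}muU : (lebesgue_measure U < m%:E)%E.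
  apply: le_lt_trans UN.
  have UE : (U `\` N) `|` N = U.
    by apply/seteqP; split=> x;
      [case=> [[]|/NU]|have [|] := pselect (N x); [right|left]].
  rewrite -[X in (_ X <= _)%E]UE measureU//.
  - by rewrite [X in (_ + X)%E]N0 adde0.
  - exact: measurableD.
  - by apply/seteqP; split => // x [[]].
have : growth_certificate U p D a (c + e1) C1 b.
  (* A point of [N] adds an interval to the certificate, any other point
     extends it at rate [c + e1]. *)
  apply: (@cousin_induction R a b) => //.
    exists 0%N, (fun=> a), (fun=> a); split => //.
    by rewrite !big_ord0 !subrr !mulr0 !addr0.
  move=> x axb; have [px dpx] := dpC x axb.
  have [Nx|Nx] := pselect (N x).
    have [d1 d10 Hd1] : exists2 d : R, 0 < d & forall y, `|x - y| < d -> U y.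
      move: oU => /(_ x (NU x Nx)) /nbhs_ballP[d /= d0 dU]; by exists d.
    have [d2 d20 Hd2] := derive_straddle px ltr01.
    exists (Num.min d1 d2); first by rewrite lt_min d10.
    move=> y z ay; rewrite ltrBlDr -ltrBlDl => xym yx xz.
    rewrite -ltrBlDl !lt_min in xym * => /andP[zd1 zd2] zb.
    case/andP: xym => yd1 yd2.
    apply: growth_certificate_cover => //; [lra|lra| |].
      move=> w /=; rewrite in_itv /= => /andP[yw wz]; apply: Hd1.
      by rewrite ltr_norml; apply/andP; split; lra.
    have := Hd2 y z; rewrite ler_norml => /(_ _ _ _ _)/andP[||||_ H]; try lra.
    have : (dp x + 1) * (z - y) <= C1 * (z - y).
      by apply: ler_wpM2r; [rewrite subr_ge0 (le_trans yx)
                           |rewrite (le_trans _ C1C) ?lerD2r].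
    lra.
  have {Nx}[Dx dpD] : is_derive x 1 D (dD x) /\ dp x - dD x <= c.
    by apply: contrapT => nx; apply: Nx; apply: subN => /= /(_ axb).
  have [d1 d10 Hd1] : exists2 d, 0 < d &
    forall y z, x - d < y -> y <= x -> x <= z -> z < x + d ->
      `|(p - D) z - (p - D) y - (dp x - dD x) * (z - y)| <= e1 * (z - y).
    by apply: derive_straddle => //; exact: is_deriveB.
  exists d1 => // y z ay dy yx xz zd zb.
  apply: growth_certificate_small; first lra.
  have := Hd1 y z dy yx xz zd; rewrite ler_norml => /andP[_].
  have : (dp x - dD x) * (z - y) <= c * (z - y).
    by apply: ler_wpM2r => //; rewrite subr_ge0 (le_trans yx).
  rewrite !fctE; lra.
move=> [n [l [u [lu ord G]]]].
have tI : trivIset setT (fun i : 'I_n => `]l i, u i[%classic).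
  apply/trivIsetP => i j _ _ ij; apply/seteqP; split => // x [] /=.
  rewrite !in_itv /= => /andP[lix xui] /andP[ljx xuj].
  have [ltij|ltij|eqij] := ltngtP i j.
  - by have := ord i j ltij (ltn_ord j); lra.
  - by have := ord j i ltij (ltn_ord i); lra.
  - by case/eqP: ij; exact/val_inj.
have sum_m : \sum_(i < n) (u i - l i) < m.
  rewrite -lte_fin; apply: le_lt_trans muU.
  by apply: disjoint_intervals_length => // i /lu[].
have sD : \sum_(i < n) `|D (u i) - D (l i)| < e2.
  apply: (acDe n (fun i => l i) (fun i => u i)) => //.
    by move=> i; have [? ? ? _] := lu i (ltn_ord i).
  by apply: lt_le_trans sum_m _; rewrite ge_min lexx.
have sC : C1 * \sum_(i < n) (u i - l i) < e2.
  rewrite -ltr_pdivlMl// mulrC; apply: lt_le_trans sum_m _.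
  by rewrite ge_min lexx orbT.
have e1b : e1 * (b - a) <= e / 2.
  have -> : e1 * (b - a) = (e / 2) * ((b - a) / (b - a + 1)).
    by rewrite /e1; field; apply/eqP; lra.
  rewrite ler_piMr//; first by rewrite divr_ge0// ltW.
  by rewrite ler_pdivrMr; lra.
rewrite /e2 in sD sC; lra.
Qed.

Lemma abs_continuousW (R : realType) (a b a' b' : R) (F : R -> R) :
  a <= a' -> b' <= b -> abs_continuous a b F -> abs_continuous a' b' F.
Proof.
move=> aa bb acF e /acF[d d0 H]; exists d => // n l u lu; apply: H => i.
by have [? [? ?]] := lu i; split; [|split] => //; lra.
Qed.

Lemma within_continuous_epsP (R : realType) (A : set R) (F : R -> R) :
  {within A, continuous F} <->
  forall x e, A x -> 0 < e -> exists2 d : R, 0 < d &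
    forall y, A y -> `|x - y| < d -> `|F x - F y| < e.
Proof.
rewrite (subspace_continuousP A F); split.
  move=> cF x e Ax e0; have /cvgrPdist_lt/(_ _ e0) := cF x Ax.
  rewrite near_withinE => /nbhs_ballP[d /= d0 dF]; exists d => // y Ay xy.
  exact: dF.
move=> cF x Ax; apply/cvgrPdist_lt => e e0.
have [d d0 dF] := cF x e Ax e0.
rewrite near_withinE; apply/nbhs_ballP; exists d => //= y xy Ay.
exact: dF.
Qed.

Lemma abs_continuous_continuous (R : realType) (a b : R) (F : R -> R) :
  abs_continuous a b F -> {within `[a, b], continuous F}.
Proof.
move=> acF; apply/within_continuous_epsP => x e /= xab e0.
have [d d0 H] := acF e e0; exists d => // y yab xy.
rewrite !in_itv /= in xab yab.
have ord (s t : R) : a <= s <= b -> a <= t <= b -> s <= t -> t - s < d ->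
    `|F t - F s| < e.
  move=> /andP[? ?] /andP[? ?] st tsd.
  have := H 1%N (fun=> s) (fun=> t); rewrite !big_ord1; apply => //.
  by move=> i j _ _ _; rewrite !ord1.
have [xley|yltx] := leP x y.
  by rewrite distrC; apply: ord => //; rewrite distrC ger0_norm ?subr_ge0 in xy.
by apply: ord => //; rewrite ?ltW// gtr0_norm ?subr_gt0 in xy *.
Qed.

Lemma last_nonpos (R : realType) (T : R) (w : R -> R) :
  0 <= T -> {within `[0, T], continuous w} -> w 0 <= 0 -> 0 < w T ->
  exists s, [/\ 0 <= s, s < T, w s <= 0 & forall t, s < t -> t <= T -> 0 < w t].
Proof.
move=> T0 /within_continuous_epsP cw w0 wT.
pose S := [set t | 0 <= t <= T /\ w t <= 0].
have S0 : S 0 by split => //; rewrite lexx T0.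
have ubS : has_ubound S by exists T => x [/andP[]].
have hS : has_sup S by split; [exists 0|].
have s0 : 0 <= sup S by exact: ub_le_sup.
have sT : sup S <= T by apply: ge_sup; [exists 0|move=> x [/andP[]]].
have ws : w (sup S) <= 0.
  rewrite leNgt; apply/negP => ws.
  have [|d d0 dw] := cw (sup S) _ _ ws; first by rewrite /= in_itv /= s0.
  have [y [/andP[y0 yT] wy] dy] := sup_adherent d0 hS.
  have ys : y <= sup S by apply: ub_le_sup => //; split => //; rewrite y0.
  have := dw y; rewrite /= in_itv /= y0 yT => /(_ isT).
  rewrite ger0_norm ?subr_ge0// ltrBlDr -ltrBlDl => /(_ dy).
  by rewrite ltr_norml => /andP[_]; lra.
exists (sup S); split => //.
  rewrite lt_neqAle sT andbT; apply/eqP => sE.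
  by rewrite sE in ws; lra.
move=> t st tT; rewrite ltNge; apply/negP => wt.
have : t <= sup S by apply: ub_le_sup => //; split => //; rewrite tT andbT; lra.
lra.
Qed.

(** Gronwall's lemma in a form free of integrals and of derivatives: where [w]
    is positive and at most [m], its growth rate is at most [K * m]. *)
Lemma nonpos_of_growth (R : realType) (K T : R) (w : R -> R) :
  0 <= K -> 0 <= T -> {within `[0, T], continuous w} -> w 0 <= 0 ->
  (forall a c m, 0 < a -> a < c -> c <= T ->
     (forall t, a <= t <= c -> 0 < w t <= m) -> w c - w a <= K * m * (c - a)) ->
  w T <= 0.
Proof.
move=> K0 T0 cw w0 gw; rewrite leNgt; apply/negP => wT.
have [s [s0 sT ws wpos]] := last_nonpos T0 cw w0 wT.
(* The step satisfies [K * h <= 1 / 2]: from the last zero [s], the function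
   would rise on [[s, s + h]] by at most half of its maximum [w c]. *)
pose h := Num.min (T - s) (2 * K + 1)^-1.
have h0 : 0 < h by rewrite lt_min subr_gt0 sT invr_gt0; lra.
have hT : s + h <= T by rewrite -lerBrDl ge_min lexx.
have Kh : K * h <= 2^-1.
  have hle : h <= (2 * K + 1)^-1 by rewrite ge_min lexx orbT.
  have K1 : 0 < 2 * K + 1 by lra.
  have : h * (2 * K + 1) <= 1 by rewrite -ler_pdivlMr// mul1r.
  lra.
have [||c csh wmax] := @EVT_max R w s (s + h).
- by rewrite lerDl ltW.
- apply: continuous_subspaceW cw => x /=; rewrite !in_itv /= => /andP[? ?].
  by apply/andP; split; lra.
rewrite in_itv /= in csh; case/andP: csh => sc csh.
have wc : 0 < w c.
  have := wmax (s + h); rewrite in_itv /= lexx andbT lerDl (ltW h0) => /(_ isT).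
  by apply: lt_le_trans; apply: wpos => //; lra.
have {}sc : s < c.
  by rewrite lt_neqAle sc andbT; apply/eqP => sE; rewrite -sE in wc; lra.
have half a : s < a -> a < c -> w c / 2 <= w a.
  move=> sa ac.
  have := gw a c (w c); have -> : 0 < a by lra.
  have -> : c <= T by lra.
  move=> /(_ isT ac isT) H.
  have {}H : w c - w a <= K * w c * (c - a).
    apply: H => t /andP[lat tc]; apply/andP; split; first by apply: wpos; lra.
    by apply: wmax; rewrite in_itv /=; apply/andP; split; lra.
  have : K * w c * (c - a) <= K * w c * h.
    by apply: ler_wpM2l; [rewrite mulr_ge0// ltW|lra].
  have : w c * (K * h) <= w c * 2^-1 by rewrite ler_pM2l.
  lra.
have cwe := (within_continuous_epsP _ _).1 cw.
have wc2 : 0 < w c / 2 by lra.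
have [|d d0 dw] := cwe s _ _ wc2; first by rewrite /= in_itv /= s0 ltW.
have [a [a1 a2 a3]] : exists a, [/\ s < a, a < c & a - s < d].
  have m0 : 0 < Num.min d (c - s) by rewrite lt_min d0 subr_gt0.
  have m1 : Num.min d (c - s) <= d by rewrite ge_min lexx.
  have m2 : Num.min d (c - s) <= c - s by rewrite ge_min lexx orbT.
  by exists (s + Num.min d (c - s) / 2); split; lra.
have a0T : `[0, T]%classic a by rewrite /= in_itv /=; apply/andP; split; lra.
have := half a a1 a2; have := dw a a0T.
rewrite distrC ger0_norm; last by rewrite subr_ge0 ltW.
move=> /(_ a3).
rewrite ltr_norml => /andP[? _]; lra.
Qed.

(** A subsolution [p] of the linear equation stays below its solution [D]. The
    differential inequality is needed only where [p] exceeds [D], which spares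
    the points where a norm is not differentiable. The coefficient [l] is only
    bounded above: this is enough because it multiplies [p - D > 0]. *)
Lemma scalar_comparison (R : realType) (l rho p D : R -> R) (y0 K : R) :
  caratheodory_solution l rho y0 D ->
  {within `[0, +oo[, continuous p} ->
  p 0 <= y0 ->
  (forall t, 0 <= t -> 0 <= p t) ->
  (forall t, 0 < t -> l t <= K) ->
  (forall a b, 0 < a -> exists C, forall t, a <= t <= b -> rho t <= C) ->
  (forall t, 0 < t -> D t < p t ->
     exists2 dp, is_derive t 1 p dp & dp <= l t * p t + rho t) ->
  forall t, 0 <= t -> p t <= D t.
Proof.
move=> [acD dD D0] cp p0 pge0 lK rhoC dp T T0.
rewrite -subr_le0.
have [->|Tneq0] := eqVneq T 0; first by rewrite D0 subr_le0.
have {Tneq0}Tgt0 : 0 < T by rewrite lt_neqAle eq_sym Tneq0.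
pose K1 := Num.max K 0.
have K10 : 0 <= K1 by rewrite le_max lexx orbT.
have KK1 : K <= K1 by rewrite le_max lexx.
have cpT : {within `[0, T], continuous p}.
  by apply: continuous_subspaceW cp => x /=; rewrite !in_itv /= => /andP[->].
apply: (@nonpos_of_growth R K1 T (p - D)) => //.
- move=> x; apply: cvgB; first exact: cpT.
  exact: abs_continuous_continuous (acD T Tgt0) x.
- by rewrite !fctE D0 subr_le0.
move=> a c m a0 ac cT wm.
have wlt t : a <= t <= c -> D t < p t.
  by move=> /wm /andP[]; rewrite !fctE subr_gt0.
have [Crho HC] := rhoC a c a0.
have [|cm _ pmax] := @EVT_max R p a c (ltW ac).
  apply: continuous_subspaceW cpT => x /=; rewrite !in_itv /= => /andP[? ?].
  by apply/andP; split; lra.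
pose dpf t := 'D_1 p t.
have dpfP t : a <= t <= c ->
    is_derive t 1 p (dpf t) /\ dpf t <= l t * p t + rho t.
  move=> tac; have /andP[lat _] := tac.
  have t0 : 0 < t by lra.
  have [q [exq valq] qle] := dp t t0 (wlt t tac).
  by rewrite /dpf valq; split.
have := @ac_growth R p dpf D (fun t => l t * D t + rho t) a c (K1 * m)
   (K1 * p cm + Crho) (ltW ac).
rewrite !fctE; apply.
- have := wm c; rewrite lexx (ltW ac) => /(_ isT)/andP[w1 w2].
  by rewrite mulr_ge0// (le_trans (ltW w1)).
- by apply: abs_continuousW (acD T Tgt0) => //; exact: ltW.
- move=> t tac; have [dpt le_dpt] := dpfP t tac; split => //.
  apply: le_trans le_dpt _; apply: lerD; last exact: HC.
  have /andP[lat _] := tac.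
  have pt0 : 0 <= p t by apply: pge0; lra.
  apply: (@le_trans _ _ (K1 * p t)).
    by apply: ler_wpM2r => //; apply: le_trans KK1; apply: lK; lra.
  by apply: ler_wpM2l => //; apply: pmax; rewrite in_itv.
apply: negligibleS dD => t; apply: contra_not => /= dDt tac.
have /andP[lat _] := tac; have t0 : 0 < t by lra.
split; first exact: dDt.
have [_ le_dpt] := dpfP t tac.
have /andP[w1 w2] := wm t tac; rewrite !fctE in w1 w2.
have : l t * (p t - D t) <= K1 * (p t - D t).
  by apply: ler_wpM2r; [exact: ltW|apply: le_trans KK1; exact: lK].
have : K1 * (p t - D t) <= K1 * m by apply: ler_wpM2l.
lra.
Qed.

(** * Euclidean geometry and the logarithmic Lipschitz constant *)

Section euclidean.
Variables (R : realType) (d : nat).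
Implicit Types x y z : 'cV[R]_d.

Lemma innerE x y : inner x y = \sum_i x i 0 * y i 0.
Proof. by rewrite /inner mxE; apply: eq_bigr => i _; rewrite mxE. Qed.

Lemma innerC x y : inner x y = inner y x.
Proof. by rewrite !innerE; apply: eq_bigr => i _; rewrite mulrC. Qed.

Lemma innerBr x y z : inner x (y - z) = inner x y - inner x z.
Proof. by rewrite /inner mulmxBr !mxE. Qed.

Lemma innerBl x y z : inner (x - y) z = inner x z - inner y z.
Proof. by rewrite !(innerC _ z) innerBr. Qed.

Lemma innerZr a x y : inner x (a *: y) = a * inner x y.
Proof. by rewrite /inner -scalemxAr !mxE. Qed.

Lemma innerZl a x y : inner (a *: x) y = a * inner x y.
Proof. by rewrite innerC innerZr innerC. Qed.

Lemma inner_ge0 x : 0 <= inner x x.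
Proof. by rewrite innerE; apply: sumr_ge0 => i _; rewrite -expr2 sqr_ge0. Qed.

Lemma inner_eq0 x : inner x x = 0 -> x = 0.
Proof.
rewrite innerE => /eqP; rewrite psumr_eq0; last first.
  by move=> i _; rewrite -expr2 sqr_ge0.
move=> /allP x0; apply/matrixP => i j; rewrite (ord1 j) mxE.
by have := x0 i (mem_index_enum i); rewrite /= mulf_eq0 orbb => /eqP.
Qed.

Lemma enorm_ge0 x : 0 <= enorm x. Proof. exact: sqrtr_ge0. Qed.

Lemma sqr_enorm x : enorm x ^+ 2 = inner x x.
Proof. by rewrite sqr_sqrtr// inner_ge0. Qed.

Lemma enorm_gt0 x : (0 < enorm x) = (x != 0).
Proof.
rewrite lt_neqAle enorm_ge0 andbT eq_sym; congr (~~ _).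
apply/eqP/eqP => [x0|->].
  by apply: inner_eq0; rewrite -sqr_enorm x0 expr0n.
by rewrite /enorm /inner trmx0 mul0mx mxE sqrtr0.
Qed.

(** Expanding [0 <= |b x - a y|^2] with [a = |x|] and [b = |y|] gives
    [0 <= 2 a b (a b - <x, y>)]. *)
Lemma cauchy_schwarz x y : inner x y <= enorm x * enorm y.
Proof.
have [->|x0] := eqVneq x 0.
  by rewrite /inner trmx0 mul0mx mxE mulr_ge0// enorm_ge0.
have [->|y0] := eqVneq y 0.
  by rewrite /inner mulmx0 mxE mulr_ge0// enorm_ge0.
have ab0 : 0 < enorm x * enorm y by rewrite mulr_gt0// enorm_gt0.
have := inner_ge0 (enorm y *: x - enorm x *: y).
rewrite !(innerBl, innerBr, innerZl, innerZr) -!sqr_enorm (innerC y x).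
set a := enorm x in ab0 *; set b := enorm y in ab0 *; set q := inner x y => H.
have {}H : 0 <= 2 * (a * b) * (a * b - q).
  apply: le_trans H _; rewrite le_eqVlt; apply/orP; left.
  by apply/eqP; ring.
by move: H; rewrite pmulr_rge0 ?subr_ge0// mulr_gt0.
Qed.

Lemma ler_inner_enorm x y : `|inner x y| <= enorm x * enorm y.
Proof.
rewrite ler_norml cauchy_schwarz andbT lerNl.
have -> : - inner x y = inner x ((-1) *: y) by rewrite innerZr mulN1r.
have -> : enorm y = enorm ((-1) *: y).
  by rewrite /enorm innerZl innerZr !mulN1r opprK.
exact: cauchy_schwarz.
Qed.

(** The Lipschitz bound makes the quotients defining [log_lip] bounded; without
    it the real supremum would be the default value [0] and would not bound
    them. *)
Section lipschitz.
Variables (g : 'cV[R]_d -> 'cV[R]_d) (L : R).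
Hypothesis gL : forall v w, enorm (g v - g w) <= L * enorm (v - w).

Let quotient_le v w : w != v ->
  inner (w - v) (g w - g v) / enorm (w - v) ^+ 2 <= `|L|.
Proof.
move=> wv; have e0 : 0 < enorm (w - v) by rewrite enorm_gt0 subr_eq0.
rewrite ler_pdivrMr ?exprn_gt0//.
apply: le_trans (cauchy_schwarz _ _) _.
rewrite expr2 mulrA mulrC ler_wpM2r ?enorm_ge0//.
by apply: le_trans (gL w v) _; rewrite ler_wpM2r ?enorm_ge0// ler_norm.
Qed.

Lemma log_lip_le v : log_lip g v <= `|L|.
Proof.
rewrite /log_lip; set S := (X in sup X).
have [->|S0] := eqVneq S set0; first by rewrite sup0.
by apply: ge_sup; [exact/set0P|move=> _ [w /= wv <-]; exact: quotient_le].
Qed.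

Lemma inner_le_log_lip v w :
  inner (w - v) (g w - g v) <= log_lip g v * enorm (w - v) ^+ 2.
Proof.
have [->|wv] := eqVneq w v.
  by rewrite sqr_enorm !subrr /inner trmx0 !mul0mx !mxE mulr0.
rewrite -ler_pdivrMr ?exprn_gt0 ?enorm_gt0 ?subr_eq0//.
apply: ub_le_sup; last by exists w.
by exists `|L| => _ [z /= zv <-]; exact: quotient_le.
Qed.

End lipschitz.
End euclidean.

(** * Derivatives of matrix-valued functions *)

Section matrix_calculus.
Variable R : realType.

Lemma is_derive_mxP m n (M : R -> 'M[R]_(m, n)) (t : R) (dM : 'M[R]_(m, n)) :
  is_derive t 1 M dM <->
  forall i j, is_derive t 1 (fun s => M s i j) (dM i j).
Proof.
split=> [[Mt <-] i j|H].
  by split; [exact: (derivable_mxP _ _ _).1 Mt i j|rewrite derive_mx// mxE].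
have Mt : derivable M t 1 by apply: (derivable_mxP _ _ _).2 => i j; have [] := H i j.
by split => //; rewrite derive_mx//; apply/matrixP => i j; rewrite mxE derive_val.
Qed.

Lemma is_derive_mulmx m n k (A : R -> 'M[R]_(m, n)) (B : R -> 'M[R]_(n, k))
    (t : R) (dA : 'M[R]_(m, n)) (dB : 'M[R]_(n, k)) :
  is_derive t 1 A dA -> is_derive t 1 B dB ->
  is_derive t 1 (fun s => A s *m B s) (dA *m B t + A t *m dB).
Proof.
move=> /is_derive_mxP At /is_derive_mxP Bt; apply/is_derive_mxP => i j.
have -> : (fun s => (A s *m B s) i j) =
    \sum_(l < n) ((fun s => A s i l) * (fun s => B s l j)).
  by apply/funext => s; rewrite mxE fct_sumE.
have H l : is_derive t 1 ((fun s => A s i l) * (fun s => B s l j))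
   (A t i l *: dB l j + B t l j *: dA i l) by exact: is_deriveM.
have := is_derive_sum H.
congr is_derive; rewrite !mxE -big_split /=; apply: eq_bigr => l _.
by rewrite addrC; congr (_ + _); exact: mulrC.
Qed.

Lemma is_derive_trmx m n (A : R -> 'M[R]_(m, n)) (t : R) (dA : 'M[R]_(m, n)) :
  is_derive t 1 A dA -> is_derive t 1 (fun s => (A s)^T) dA^T.
Proof.
move=> /is_derive_mxP At; apply/is_derive_mxP => i j; rewrite mxE.
by have := At j i; congr is_derive; apply/funext => s; rewrite mxE.
Qed.

Lemma is_derive_enorm d (x : R -> 'cV[R]_d) (t : R) (dx : 'cV[R]_d) :
  is_derive t 1 x dx -> x t != 0 ->
  is_derive t 1 (fun s => enorm (x s)) (inner (x t) dx / enorm (x t)).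
Proof.
move=> xt xt0.
have ixx : is_derive t 1 (fun s => inner (x s) (x s)) (2 * inner (x t) dx).
  have /is_derive_mxP/(_ 0 0) := is_derive_mulmx (is_derive_trmx xt) xt.
  congr is_derive; rewrite mxE -![(_ *m _) 0 0]/(inner _ _) (innerC dx).
  by rewrite mulr_natl mulr2n.
have i0 : 0 < inner (x t) (x t) by rewrite -sqr_enorm exprn_gt0// enorm_gt0.
have := @is_derive1_comp R Num.sqrt (fun s => inner (x s) (x s)) t _ _
  (is_derive1_sqrt i0) ixx.
congr is_derive; rewrite -/(enorm _).
have : enorm (x t) != 0 by rewrite gt_eqF// enorm_gt0.
by move=> ?; rewrite /GRing.scale /=; field.
Qed.

Lemma enorm_continuous d : continuous (@enorm R d).
Proof.
have ci : continuous (fun x : 'cV[R]_d => inner x x).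
  have -> : (fun x : 'cV[R]_d => inner x x) = (fun x => \sum_i x i 0 * x i 0).
    by apply/funext => z; rewrite innerE.
  apply: continuous_big; first exact: add_continuous.
  have cc i : continuous (fun x : 'cV[R]_d => x i 0) by exact: coord_continuous.
  by move=> i _ z; exact: (continuousM (cc i z) (cc i z)).
move=> x; apply: (continuous_comp (ci x)); exact: sqrt_continuous.
Qed.

End matrix_calculus.

(** * The Galerkin equation in a moving reduced space *)

Section reduced_space.
Variables (R : realType) (d r : nat) (U : {vspace 'cV[R]_d}).
Implicit Types (P : 'M[R]_d) (B : 'M[R]_(d, r)).

Lemma orth_projector_id P x : orth_projector U P -> x \in U -> P *m x = x.
Proof.
move=> /(_ x)[PxU orth] xU; apply/eqP; rewrite eq_sym -subr_eq0; apply/eqP.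
by apply: inner_eq0; apply: orth; rewrite memvB.
Qed.

Lemma orthonormal_basis_mem B (a : 'cV[R]_r) :
  orthonormal_basis U B -> B *m a \in U.
Proof.
move=> [bU _].
have -> : B *m a = \sum_j a j 0 *: col j B.
  apply/matrixP => i k; rewrite (ord1 k) mxE summxE; apply: eq_bigr => j _.
  by rewrite !mxE mulrC.
apply: memv_suml => j _; apply: memvZ; apply: (basis_mem bU).
by apply: map_f; rewrite mem_enum.
Qed.

(** [x] is some [B *m a] since the columns of [B] span [U], and [B^T] recovers
    [a] by orthonormality. *)
Lemma orthonormal_basis_coord B x :
  orthonormal_basis U B -> x \in U -> B *m (B^T *m x) = x.
Proof.
move=> [bU orth] xU.
have BtB : B^T *m B = 1%:M.
  apply/matrixP => i j; rewrite [RHS]mxE -orth /inner !mxE.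
  by apply: eq_bigr => k _; rewrite !mxE.
have : (U <= limg (linfun (mulmx B : 'cV[R]_r -> 'cV[R]_d)))%VS.
  have /andP[/eqP<- _] := bU; apply/span_subvP => _ /mapP[j _ ->].
  have -> : col j B = linfun (mulmx B : 'cV[R]_r -> 'cV[R]_d) (delta_mx j 0).
    by rewrite lfunE /= colE.
  by rewrite memv_img// memvf.
move=> /subvP/(_ x xU)/memv_imgP[a _ ->].
by rewrite lfunE /= (mulmxA _ B) BtB mul1mx.
Qed.

End reduced_space.

(** The full velocity of the Galerkin approximation: the flux plus the
    residual. The Galerkin condition gives the projection of [x'] on the reduced
    space; differentiating [x = V (V^T x)] gives the rest, since the derivative
    of the coordinates contributes [V t *m da'], which lies in [Xr t]. *)
Lemma galerkin_derive (R : realType) (d r : nat)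
    (Xr : R -> {vspace 'cV[R]_d}) (V : R -> 'M[R]_(d, r)) (Pi : R -> 'M[R]_d)
    (g : 'cV[R]_d -> R -> 'cV[R]_d) (x0 : 'cV[R]_d) (x : R -> 'cV[R]_d) :
  (forall t : R, 0 < t -> orthonormal_basis (Xr t) (V t)) -> C1_pos V ->
  (forall t : R, 0 <= t -> orth_projector (Xr t) (Pi t)) ->
  galerkin Xr Pi g x0 x ->
  forall t : R, 0 < t ->
    is_derive t 1 x (g (x t) t + residual Pi V g x t).
Proof.
move=> Vb V1 Pp [xX cx x1 Px _] t t0.
have [Vt _] := V1 t t0; have [xt _] := x1 t t0.
split => //.
have dV : is_derive t 1 V (V^`()%classic t) by rewrite derive1E; exact: derivableP.
have dx : is_derive t 1 x (x^`()%classic t) by rewrite derive1E; exact: derivableP.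
have da := is_derive_mulmx (is_derive_trmx dV) dx.
have dy := is_derive_mulmx dV da.
set da' := (X in V t *m X) in dy.
have xE : x^`()%classic t = V^`()%classic t *m ((V t)^T *m x t) + V t *m da'.
  have <- := @derive_val _ _ _ _ _ _ _ dy.
  rewrite derive1E; apply: near_eq_derive.
  near=> s; have s0 : 0 < s by near: s; exact: lt_nbhsr.
  by rewrite (orthonormal_basis_coord (Vb s s0))// xX// ltW.
have PV : Pi t *m (V t *m da') = V t *m da'.
  by apply: orth_projector_id (Pp t (ltW t0)) _; exact: orthonormal_basis_mem (Vb t t0).
have Pg : Pi t *m g (x t) t =
    Pi t *m (V^`()%classic t *m ((V t)^T *m x t)) + V t *m da'.
  by rewrite -(Px t t0) xE mulmxDr PV.
rewrite -derive1E /residual -mulmxA mulmxBl mul1mx mulmxBr Pg xE.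
move: (V^`()%classic t *m _) (V t *m da') (g _ _) (Pi t *m _) => w v gx Pw.
by apply/matrixP => i j; rewrite !mxE; ring.
Unshelve. all: by end_near. Qed.

(** * The error bound *)

Lemma C1_pos_continuous (R : realType) (W : normedModType R) (x : R -> W)
    (t : R) :
  C1_pos x -> 0 < t -> {for t, continuous x}.
Proof.
move=> x1 t0; have [xt _] := x1 t t0.
exact/differentiable_continuous/derivable1_diffP.
Qed.

(** The flux is continuous only relative to [0 <= t], but a curve at a positive
    time stays in that region. *)
Lemma flux_along_continuous (R : realType) (d : nat)
    (g : 'cV[R]_d -> R -> 'cV[R]_d) (x : R -> 'cV[R]_d) (t : R) :
  {within [set p : 'cV[R]_d * R | 0 <= p.2],
     continuous (fun p : 'cV[R]_d * R => g p.1 p.2)} ->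
  0 < t -> {for t, continuous x} ->
  {for t, continuous (fun s => g (x s) s)}.
Proof.
move=> /subspace_continuousP cg t0 cx.
have := cg (x t, t) (ltW t0).
apply: (@cvg_comp _ _ _ (fun s => (x s, s)) (fun p : 'cV[R]_d * R => g p.1 p.2)
  (nbhs t)).
have cxs : (fun s => (x s, s)) @ t --> (x t, t).
  exact: (cvg_pair cx (@cvg_id _ (nbhs t))).
move=> A /cxs; rewrite /= !near_simpl => HA.
rewrite -nbhs_nearE; near=> s.
have /= : 0 <= (x s, s).2 -> A (x s, s) by near: s; exact: HA.
apply; apply: ltW; near: s; exact: lt_nbhsr.
Unshelve. all: by end_near. Qed.

Lemma continuous_pos_bounded (R : realType) (h : R -> R) (a b : R) :
  (forall t : R, 0 < t -> {for t, continuous h}) -> 0 < a ->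
  exists C, forall t : R, a <= t <= b -> h t <= C.
Proof.
move=> ch a0; have [ab|ba] := leP a b; last by exists 0 => t /andP[? ?]; lra.
have [|c _ hc] := @EVT_max R h a b ab.
  apply: continuous_in_subspaceT => t; rewrite inE /= in_itv /= => /andP[at_ _].
  by apply: ch; exact: lt_le_trans at_.
by exists (h c) => t tab; apply: hc; rewrite in_itv.
Qed.
Theorem proposition1 (R : realType) (d r : nat) (Xi : Type)
    (u0 : Xi -> 'cV[R]_d)
    (f : 'cV[R]_d -> R -> Xi -> 'cV[R]_d)
    (u ur : R -> Xi -> 'cV[R]_d)
    (Xr : R -> {vspace 'cV[R]_d})
    (V : R -> 'M[R]_(d, r))
    (Pi : R -> 'M[R]_d)
    (Delta : R -> Xi -> R)
    (f_regular : forall xi : Xi, regular_flux (fun v t => f v t xi))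
    (u_solution : forall xi : Xi,
       ivp_solution (fun v t => f v t xi) (u0 xi) (fun t => u t xi))
    (Xr_dim : forall t : R, 0 < t -> \dim (Xr t) = r)
    (V_basis : forall t : R, 0 < t -> orthonormal_basis (Xr t) (V t))
    (V_C1 : C1_pos V)
    (V'_bounded : exists M : R, forall t : R, 0 < t -> `|V^`()%classic t| <= M)
    (Pi_projector : forall t : R, 0 <= t -> orth_projector (Xr t) (Pi t))
    (ur_galerkin : forall xi : Xi,
       galerkin Xr Pi (fun v t => f v t xi) (u0 xi) (fun t => ur t xi))
    (Delta_solution : forall xi : Xi,
       caratheodory_solution
         (fun t => log_lip (fun v => f v t xi) (ur t xi))
         (fun t => enorm (residual Pi V (fun v s => f v s xi)
                            (fun s => ur s xi) t))
         (enorm (u 0 xi - ur 0 xi))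
         (fun t => Delta t xi)) :
  forall xi : Xi,
    u 0 xi - ur 0 xi = u0 xi - Pi 0 *m u0 xi /\
    forall t : R, 0 <= t -> enorm (u t xi - ur t xi) <= Delta t xi.
Proof.
move=> xi; have [cu du u0E] := u_solution xi.
have [urX cur ur1 Pur ur0E] := ur_galerkin xi.
split; first by rewrite u0E ur0E.
have [cf [L fL]] := f_regular xi.
pose e (t : R) := u t xi - ur t xi.
pose res (t : R) := residual Pi V (fun v s => f v s xi) (fun s => ur s xi) t.
have dur := galerkin_derive V_basis V_C1 Pi_projector (ur_galerkin xi).
have resE (t : R) : 0 < t ->
    res t = (fun s => ur s xi)^`()%classic t - f (ur t xi) t xi.
  by move=> t0; rewrite derive1E (@derive_val _ _ _ _ _ _ _ (dur t t0)) addrC addKr.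
have res_bounded (a b : R) : 0 < a ->
    exists C, forall t : R, a <= t <= b -> enorm (res t) <= C.
  move=> a0.
  have [|C HC] := @continuous_pos_bounded R
    (fun t => enorm ((fun s => ur s xi)^`()%classic t - f (ur t xi) t xi)) a b _ a0.
    move=> t t0; have [_ cur't] := ur1 t t0.
    have cft := @flux_along_continuous _ _ (fun v s => f v s xi) _ t cf t0
      (C1_pos_continuous ur1 t0).
    apply: (continuous_comp (continuousB cur't cft)); exact: enorm_continuous.
  exists C => t tab; rewrite resE; first exact: HC.
  by case/andP: tab => [lat _]; exact: lt_le_trans lat.
have de (t : R) : 0 < t ->
    is_derive t 1 e (f (u t xi) t xi - f (ur t xi) t xi - res t).
  move=> t0; rewrite -addrA -opprD.
  exact: (@is_deriveB _ _ _ _ _ _ _ _ _ (du t t0) (dur t t0)).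
have lK (t : R) : 0 < t -> log_lip (fun v => f v t xi) (ur t xi) <= `|L|.
  by move=> t0; apply: log_lip_le => v w; apply: fL; exact: ltW.
have comparison := scalar_comparison (Delta_solution xi).
have Delta0 (t : R) : 0 <= t -> 0 <= Delta t xi.
  apply: (comparison (fun=> 0) `|L|) => //.
  - by apply: continuous_subspaceT => x; exact: cvg_cst.
  - exact: enorm_ge0.
  - move=> s s0 _; exists 0; first exact: is_derive_cst.
    by rewrite mulr0 add0r enorm_ge0.
apply: (comparison (fun t => enorm (e t)) `|L|) => //.
- move=> x; apply: continuous_comp; last exact: enorm_continuous.
  by apply: cvgB; [exact: cu|exact: cur].
- by move=> t _; exact: enorm_ge0.
move=> t t0 Dlt.
have et0 : 0 < enorm (e t) by apply: le_lt_trans Dlt; apply: Delta0; exact: ltW.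
have et_neq0 : e t != 0 by rewrite -enorm_gt0.
exists (inner (e t) (f (u t xi) t xi - f (ur t xi) t xi - res t) / enorm (e t)).
  exact: is_derive_enorm (de t t0) et_neq0.
rewrite ler_pdivrMr// mulrDl -mulrA -expr2 innerBr; apply: lerD.
  apply: (@inner_le_log_lip _ _ (fun v => f v t xi) L) => v w.
  by apply: fL; exact: ltW.
rewrite mulrC; apply: le_trans (ler_inner_enorm _ _).
by rewrite -normrN ler_norm.
Qed.
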